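(* Let $A$ be a $C^*$-algebra, $H$ a Hilbert $A$-module, and let $P,Q\in\mathcal{L}(H)$ be two projections such that $\overline{\mathcal{R}(P+Q)}$ and $\overline{\mathcal{R}(2I-P-Q)}$ are both orthogonally complemented in $H$. Then $$\big\Vert PQ\big(I-P_{\mathcal{R}(P)\cap\mathcal{R}(Q)}\big)\big\Vert=\big\Vert(I-P)(I-Q)\big(I-P_{\mathcal{N}(P)\cap\mathcal{N}(Q)}\big)\big\Vert.$$
   Context: $\mathcal{L}(H)$ is the $C^*$-algebra of adjointable operators on the Hilbert $A$-module $H$; a projection is $P\in\mathcal{L}(H)$ with $P=P^2=P^*$; $\mathcal{R}$ and $\mathcal{N}$ denote range and null space. A closed submodule $M\subseteq H$ is orthogonally complemented in $H$ if $H=M+M^\perp$, where $M^\perp=\{x\in H:\langle x,y\rangle=0\ \forall y\in M\}$; then $P_M$ denotes the projection in $\mathcal{L}(H)$ with range $M$. Under the hypotheses $\mathcal{R}(P)\cap\mathcal{R}(Q)=\overline{\mathcal{R}(2I-P-Q)}^\perp$ and $\mathcal{N}(P)\cap\mathcal{N}(Q)=\overline{\mathcal{R}(P+Q)}^\perp$ are orthogonally complemented, so the projections in the claim are meaningful. *)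

(* Defs.v *)
From HB Require Import structures.
From mathcomp Require Import all_boot all_order all_algebra.
From mathcomp Require Import all_classical all_reals all_analysis.
From mathcomp Require Import complex.

Set Implicit Arguments.
Unset Strict Implicit.
Unset Printing Implicit Defensive.

Import Order.TTheory GRing.Theory Num.Theory.
Import numFieldNormedType.Exports.

Local Open Scope classical_set_scope.
Local Open Scope ring_scope.
Local Open Scope complex_scope.

(* C*-algebras are not assumed to be unital, so the product is not the one of
   a MathComp ring.  As always over [R[i]], norms take their values in [R[i]]
   (and are nonnegative reals there). *)
HB.mixin Record CompleteNormedModule_isCStarAlgebra (R : realType) A
    of CompleteNormedModule R[i] A := {
  amul : A -> A -> A;
  astar : A -> A;
  amulA : forall a b c, amul a (amul b c) = amul (amul a b) c;
  amulDl : forall a b c, amul (a + b) c = amul a c + amul b c;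
  amulDr : forall a b c, amul a (b + c) = amul a b + amul a c;
  amulZl : forall (l : R[i]) a b, amul (l *: a) b = l *: amul a b;
  amulZr : forall (l : R[i]) a b, amul a (l *: b) = l *: amul a b;
  astarK : forall a, astar (astar a) = a;
  astarD : forall a b, astar (a + b) = astar a + astar b;
  astarZ : forall (l : R[i]) a, astar (l *: a) = l^* *: astar a;
  astarM : forall a b, astar (amul a b) = amul (astar b) (astar a);
  amul_norm_le : forall a b, `|amul a b| <= `|a| * `|b|;
  cstar_identity : forall a, `|amul (astar a) a| = `|a| ^+ 2
}.

#[short(type="cStarAlgType")]
HB.structure Definition CStarAlgebra (R : realType) :=
  { A of CompleteNormedModule_isCStarAlgebra R A
       & CompleteNormedModule R[i] A }.

Section Positivity.
Context {R : realType} {A : cStarAlgType R}.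

(* Product of the unitization [C (+) A], whose unit is [(1, 0)]. *)
Definition unitization_mul (x y : R[i] * A) : R[i] * A :=
  (x.1 * y.1, x.1 *: y.2 + y.1 *: x.2 + amul x.2 y.2).

(* The spectrum is computed in the unitization; when [A] already has a unit
   this can only add the point [0], which is immaterial for positivity. *)
Definition spectrum (a : A) : set R[i] :=
  [set l | ~ exists y, unitization_mul (l, - a) y = (1, 0) /\
                       unitization_mul y (l, - a) = (1, 0)].

(* In [R[i]], [0 <= l] means that [l] is real and nonnegative. *)
Definition positive (a : A) : Prop :=
  astar a = a /\ forall l, spectrum a l -> 0 <= l.

End Positivity.

(* Right modules, with an inner product that is linear in its second
   variable.  Completeness is with respect to [|x| = |<x, x>|^(1/2)]. *)
HB.mixin Record CompleteNormedModule_isHilbertModule (R : realType)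
    (A : cStarAlgType R) H of CompleteNormedModule R[i] H := {
  mact : H -> A -> H;
  inner : H -> H -> A;
  mactDl : forall x y a, mact (x + y) a = mact x a + mact y a;
  mactDr : forall x a b, mact x (a + b) = mact x a + mact x b;
  mactA : forall x a b, mact x (amul a b) = mact (mact x a) b;
  mactZl : forall (l : R[i]) x a, mact (l *: x) a = l *: mact x a;
  mactZr : forall (l : R[i]) x a, mact x (l *: a) = l *: mact x a;
  innerDr : forall x y z, inner x (y + z) = inner x y + inner x z;
  innerZr : forall (l : R[i]) x y, inner x (l *: y) = l *: inner x y;
  inner_act : forall x y a, inner x (mact y a) = amul (inner x y) a;
  inner_star : forall x y, inner y x = astar (inner x y);
  inner_ge0 : forall x, positive (inner x x);
  inner_eq0 : forall x, inner x x = 0 -> x = 0;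
  inner_norm : forall x, `|x| ^+ 2 = `|inner x x|
}.

#[short(type="hilbertModType")]
HB.structure Definition HilbertModule (R : realType) (A : cStarAlgType R) :=
  { H of CompleteNormedModule_isHilbertModule R A H
       & CompleteNormedModule R[i] H }.

Section Operators.
Context {R : realType} {A : cStarAlgType R} {H : hilbertModType A}.
Implicit Types (S T P : H -> H) (M : set H).

Definition adjoint_of T S : Prop :=
  forall x y, inner (T x) y = inner x (S y) :> A.

(* The elements of L(H); linearity over [R[i]] and [A] and boundedness follow
   from the existence of an adjoint. *)
Definition adjointable T : Prop := exists S, adjoint_of T S.

Definition projection P : Prop :=
  [/\ adjointable P, P \o P = P & adjoint_of P P].

Definition null_space T : set H := [set x | T x = 0].

Definition orthogonal_complement M : set H :=
  [set x | forall y, M y -> inner x y = 0 :> A].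

Definition orthogonally_complemented M : Prop :=
  forall x, exists y z,
    [/\ M y, orthogonal_complement M z & x = y + z].

(* P_M, the projection in L(H) with range [M]; the default value [0] is only
   taken when there is no such projection. *)
Definition proj_onto M : H -> H :=
  xget (fun=> 0) [set P | projection P /\ range P = M].

(* Extended-real valued so as to be meaningful for every map; it is finite on
   L(H). *)
Definition opnorm T : \bar R :=
  ereal_sup [set (complex.Re `|T x|)%:E | x in [set x : H | `|x| <= 1]].

End Operators.

(* Main.v *)
Require Import Defs.
From HB Require Import structures.
From mathcomp Require Import all_boot all_order all_algebra.
From mathcomp Require Import all_classical all_reals all_analysis.
From mathcomp Require Import complex ring lra.

(* Put S = P + Q - 1 and D = P - Q. Then S^2 + D^2 = 1, PQ = SQ, (1 - P)(1 - Q)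
   = - S (1 - Q), S and D anticommute and Q (SD) = (SD) (1 - Q). On the
   invariant submodule K orthogonal to the common range and to the common null
   space, D has dense range (this is where complementation is used), so that
   bounds for the powers of S on the kernel of Q are transported by SD to the
   range of Q, up to a constant factor. The constant disappears because a self-
   adjoint T with |T^(2k) x| = O(b^(2k)) satisfies |T x| <= b |x|: for b = 1, T
   x is the mean of the vectors (T +- i (1 - T^2)^(1/2)) x, which have the norm
   of x. Approximating the square root by polynomials in T with an explicit
   error makes all this independent of the order structure of A: it only uses
   the triangle inequality and |x|^2 = |<x, x>|. *)

Import Order.TTheory GRing.Theory Num.Theory.
Import numFieldNormedType.Exports.

Local Open Scope classical_set_scope.
Local Open Scope ring_scope.

(* The square-zero extension [K (+) V] turns linear identities in the module [V]
   into identities that [ring] can decide. *)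
Definition sqz (K : comNzRingType) (V : lmodType K) : Type := (K * V)%type.

Section SquareZero.
Context {K : comNzRingType} {V : lmodType K}.

HB.instance Definition _ := GRing.Zmodule.on (sqz K V).

Definition sqz_mul (x y : sqz K V) : sqz K V :=
  (x.1 * y.1, x.1 *: y.2 + y.1 *: x.2).

Fact sqz_mulA : associative sqz_mul.
Proof.
move=> x y z; congr (_, _) => /=; first by rewrite mulrA.
by rewrite !scalerDr !scalerA addrA (mulrC z.1 x.1) (mulrC z.1 y.1).
Qed.

Fact sqz_mulC : commutative sqz_mul.
Proof. by move=> x y; congr (_, _); rewrite /= ?(mulrC x.1) // addrC. Qed.

Fact sqz_mul1 : left_id ((1, 0) : sqz K V) sqz_mul.
Proof.
by move=> [a x]; congr (_, _); rewrite /= ?mul1r // scale1r scaler0 addr0.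
Qed.

Fact sqz_mulDl : left_distributive sqz_mul +%R.
Proof.
move=> x y z; congr (_, _) => /=; first by rewrite mulrDl.
by rewrite scalerDl scalerDr addrACA.
Qed.

Fact sqz_1neq0 : ((1, 0) : sqz K V) != 0.
Proof. by rewrite xpair_eqE oner_eq0. Qed.

HB.instance Definition _ := GRing.Zmodule_isComNzRing.Build (sqz K V)
  sqz_mulA sqz_mulC sqz_mul1 sqz_mulDl sqz_1neq0.

Definition sqz_in (x : V) : sqz K V := (0, x).

Definition sqz_sc (a : K) : sqz K V := (a, 0).

Fact sqz_in_additive : zmod_morphism sqz_in.
Proof. by move=> x y; congr (_, _); rewrite /= subr0. Qed.

HB.instance Definition _ := GRing.isZmodMorphism.Build V (sqz K V)
  sqz_in sqz_in_additive.

Fact sqz_sc_additive : zmod_morphism sqz_sc.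
Proof. by move=> x y; congr (_, _); rewrite /= subr0. Qed.

HB.instance Definition _ := GRing.isZmodMorphism.Build K (sqz K V)
  sqz_sc sqz_sc_additive.

Fact sqz_sc_mul : monoid_morphism sqz_sc.
Proof. by split=> // x y; congr (_, _); rewrite /= !scaler0 addr0. Qed.

HB.instance Definition _ := GRing.isMonoidMorphism.Build K (sqz K V)
  sqz_sc sqz_sc_mul.

Lemma sqz_inZ a x : sqz_in (a *: x) = sqz_sc a * sqz_in x.
Proof. by congr (_, _); rewrite /= ?mulr0 // scaler0 addr0. Qed.

Lemma sqz_in_inj : injective sqz_in.
Proof. by move=> x y []. Qed.

End SquareZero.

Lemma sqz_inD {K : comNzRingType} {V : lmodType K} (x y : V) :
  sqz_in (x + y) = sqz_in x + sqz_in y.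
Proof. exact: raddfD. Qed.

Lemma sqz_inN {K : comNzRingType} {V : lmodType K} (x : V) :
  sqz_in (- x) = - sqz_in x.
Proof. exact: raddfN. Qed.

Lemma sqz_in0 {K : comNzRingType} {V : lmodType K} : sqz_in (0 : V) = 0.
Proof. exact: raddf0. Qed.

Definition sqz_inE := (@sqz_inD, @sqz_inN, @sqz_in0, @sqz_inZ).

Ltac module :=
  apply: sqz_in_inj; rewrite ?sqz_inE; ring.

(** * The norm as a real number *)

Section RealNorm.
Local Open Scope complex_scope.
Context {R : realType} {V : normedModType R[i]}.
Implicit Types (x y : V) (r : R).

(** Norms live in [R[i]]; passing to the real part makes [lra] and [nra] applicable. *)
Definition nrm x : R := complex.Re `|x|.

Lemma nrmE x : `|x| = (nrm x)%:C.
Proof. by rewrite /nrm RRe_real // normr_real. Qed.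

Lemma nrm_ge0 x : 0 <= nrm x.
Proof. by rewrite -lecR -nrmE normr_ge0. Qed.

Lemma nrm0 : nrm 0 = 0.
Proof. by rewrite /nrm normr0. Qed.

Lemma nrm_eq0 x : nrm x = 0 -> x = 0.
Proof. by move=> x0; apply/eqP; rewrite -normr_eq0 nrmE x0. Qed.

Lemma nrmD x y : nrm (x + y) <= nrm x + nrm y.
Proof. by rewrite -lecR rmorphD /= -!nrmE ler_normD. Qed.

Lemma nrmN x : nrm (- x) = nrm x.
Proof. by rewrite /nrm normrN. Qed.

Lemma nrmB x y : nrm (x - y) <= nrm x + nrm y.
Proof. by rewrite -(nrmN y) nrmD. Qed.

Lemma nrmZ (c : R[i]) x : nrm (c *: x) = complex.Re `|c| * nrm x.
Proof.
have /complexI -> // : (nrm (c *: x))%:C = (complex.Re `|c| * nrm x)%:C.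
by rewrite rmorphM /= -!nrmE normrZ nrmE RRe_real ?normr_real.
Qed.

Lemma nrmZr r x : nrm (r%:C *: x) = `|r| * nrm x.
Proof. by rewrite nrmZ normc_def /= expr0n addr0 sqrtr_sqr. Qed.

Lemma nrmZi x : nrm ('i *: x) = nrm x.
Proof. by rewrite nrmZ normc_def /= expr0n add0r expr1n sqrtr1 mul1r. Qed.

Lemma nrmZn n x : nrm (n%:R *: x) = n%:R * nrm x.
Proof. by rewrite -(rmorph_nat (real_complex R)) nrmZr normr_nat. Qed.

Lemma closure_nrm (M : set V) x (e : R) : closure M x -> 0 < e ->
  exists2 y, M y & nrm (x - y) < e.
Proof.
move=> Mx e0; have eC : 0 < e%:C by rewrite ltcR.
have [y [My xy]] := Mx _ (nbhsx_ballx x _ eC).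
by exists y => //; move: xy; rewrite -ball_normE /ball_ /= nrmE ltcR.
Qed.

End RealNorm.

(** * Sesquilinearity and polarization of the inner product *)

Section Inner.
Local Open Scope complex_scope.
Context {R : realType} {A : cStarAlgType R} {H : hilbertModType A}.
Implicit Types (x y z : H) (S T P : H -> H).
Local Notation ip := (@inner R A H).

Lemma astar0 : astar (0 : A) = 0.
Proof. by rewrite -[X in astar X](scale0r (0 : A)) astarZ rmorph0 scale0r. Qed.

Lemma innerDl x y z : ip (x + y) z = ip x z + ip y z.
Proof. by rewrite inner_star innerDr astarD -!inner_star. Qed.

Lemma innerZl (c : R[i]) x y : ip (c *: x) y = c^* *: ip x y.
Proof. by rewrite inner_star innerZr astarZ -inner_star. Qed.

Lemma innerNr x y : ip x (- y) = - ip x y.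
Proof. by rewrite -scaleN1r innerZr scaleN1r. Qed.

Lemma innerNl x y : ip (- x) y = - ip x y.
Proof. by rewrite -scaleN1r innerZl rmorphN rmorph1 scaleN1r. Qed.

Lemma inner0r x : ip x 0 = 0.
Proof. by rewrite -(scale0r x) innerZr scale0r. Qed.

Lemma inner0l x : ip 0 x = 0.
Proof. by rewrite inner_star inner0r astar0. Qed.

Lemma innerBr x y z : ip x (y - z) = ip x y - ip x z.
Proof. by rewrite innerDr innerNr. Qed.

Lemma innerBl x y z : ip (x - y) z = ip x z - ip y z.
Proof. by rewrite innerDl innerNl. Qed.

Lemma inner_ext x y : (forall z, ip z x = ip z y) -> x = y.
Proof.
move=> xy; apply/eqP; rewrite -subr_eq0; apply/eqP; apply: (inner_eq0 (s:=H)).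
by rewrite innerBr xy subrr.
Qed.

Lemma nrm_inner x : nrm (ip x x) = nrm x ^+ 2.
Proof.
have /complexI -> // : (nrm (ip x x))%:C = (nrm x ^+ 2)%:C.
by rewrite rmorphXn /= -!nrmE inner_norm.
Qed.

Lemma polarization x y : 4%:R *: (ip x y) =
  (ip (x + y) (x + y)) - (ip (x - y) (x - y))
  - 'i *: ((ip (x + 'i *: y) (x + 'i *: y)) - (ip (x - 'i *: y) (x - 'i *: y))).
Proof.
rewrite !innerDl !innerDr !innerNl !innerNr !innerZl !innerZr conjCi.
have ii : sqz_sc ('i : R[i]) * sqz_sc 'i = -1 :> sqz _ A.
  by rewrite -rmorphM -expr2 sqrCi rmorphN1.
apply: sqz_in_inj; rewrite !sqz_inE ?rmorphN.
ring: ii.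
Qed.

End Inner.

(** * Self-adjoint maps, a weak Cauchy-Schwarz bound and the iteration for [sqrt (1 - B)] *)

Section SelfAdjoint.
Local Open Scope complex_scope.
Context {R : realType} {A : cStarAlgType R} {H : hilbertModType A}.
Implicit Types (x y z : H) (S T P B : H -> H) (M : R).
Local Notation ip := (@inner R A H).

Lemma nrm_inner_le_sqr x y : nrm (ip x y) <= (nrm x + nrm y) ^+ 2.
Proof.
suff : 4%:R * nrm (ip x y) <= 4%:R * (nrm x + nrm y) ^+ 2.
  by rewrite ler_pM2l // ltr0n.
have sq z : nrm z <= nrm x + nrm y -> nrm (ip z z) <= (nrm x + nrm y) ^+ 2.
  by move=> ?; rewrite nrm_inner lerXn2r ?nnegrE ?addr_ge0 ?nrm_ge0.
rewrite -nrmZn polarization.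
apply: le_trans (nrmB _ _) _; rewrite nrmZi.
have h1 := nrmB (ip (x + y) (x + y)) (ip (x - y) (x - y)).
have h2 := nrmB (ip (x + 'i *: y) (x + 'i *: y)) (ip (x - 'i *: y) (x - 'i *: y)).
have := sq _ (nrmD x y); have := sq _ (nrmB x y).
have := nrmD x ('i *: y); have := nrmB x ('i *: y); rewrite nrmZi => /sq + /sq.
by move: h1 h2; lra.
Qed.

Lemma innerZlr (r : R) x y : ip (r%:C *: x) y = r%:C *: ip x y.
Proof. by rewrite innerZl conj_Creal // complex_real. Qed.

(** Polarization bounds [ip x y] by [(1 + 1)^2 = 4] on unit vectors; scaling does the rest. The
    factor 4 is harmless: the bound is only applied to errors that tend to 0. *)
Lemma nrm_inner_le x y : nrm (ip x y) <= 4%:R * nrm x * nrm y.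
Proof.
have [x0|x0] := eqVneq (nrm x) 0.
  by rewrite (nrm_eq0 _ x0) inner0l !nrm0 mulr0 mul0r.
have [y0|y0] := eqVneq (nrm y) 0.
  by rewrite (nrm_eq0 _ y0) inner0r !nrm0 mulr0.
have := nrm_inner_le_sqr ((nrm x)^-1%:C *: x) ((nrm y)^-1%:C *: y).
rewrite innerZlr innerZr !nrmZr !ger0_norm ?invr_ge0 ?nrm_ge0 // !mulVf //.
have x1 : 0 < nrm x by rewrite lt_def x0 nrm_ge0.
have y1 : 0 < nrm y by rewrite lt_def y0 nrm_ge0.
rewrite ler_pdivrMl // ler_pdivrMl // => /le_trans; apply.
by rewrite le_eqVlt; apply/orP; left; apply/eqP; ring.
Qed.

Lemma adjointD T S x y : adjoint_of T S -> T (x + y) = T x + T y.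
Proof.
move=> TS; apply: inner_ext => z.
by rewrite inner_star TS innerDl astarD -!TS -!inner_star -innerDr.
Qed.

Lemma adjointZ T S c x : adjoint_of T S -> T (c *: x) = c *: T x.
Proof.
move=> TS; apply: inner_ext => z.
rewrite inner_star TS innerZl astarZ -TS -inner_star innerZr.
by rewrite conjCK.
Qed.

Definition self_adjoint T := adjoint_of T T.

Lemma saN T : self_adjoint T -> forall x, T (- x) = - T x.
Proof. by move=> hT x; rewrite -scaleN1r (adjointZ _ _ _ _ hT) scaleN1r. Qed.

Lemma saD T : self_adjoint T -> forall x y, T (x + y) = T x + T y.
Proof. by move=> hT x y; exact: adjointD hT. Qed.

Lemma saZ T : self_adjoint T -> forall c x, T (c *: x) = c *: T x.
Proof. by move=> hT c x; exact: adjointZ hT. Qed.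

Lemma saB T : self_adjoint T -> forall x y, T (x - y) = T x - T y.
Proof. by move=> hT x y; rewrite saD // saN. Qed.

Lemma sa0 T : self_adjoint T -> T 0 = 0.
Proof. by move=> hT; rewrite -(scale0r 0) saZ // !scale0r. Qed.

Lemma self_adjoint_iter k B : self_adjoint B -> self_adjoint (iter k B).
Proof. by move=> hB; elim: k => [//|k IH] x y; rewrite iterS hB IH -iterSr. Qed.

Lemma self_adjoint_sqr T : self_adjoint T -> self_adjoint (T \o T).
Proof. exact: (self_adjoint_iter 2). Qed.

Lemma self_adjointZ (r : R) T :
  self_adjoint T -> self_adjoint (fun x => r%:C *: T x).
Proof. by move=> hT x y; rewrite innerZlr innerZr hT. Qed.

(* Converges to [1 - sqrt (1 - B)]. *)
Fixpoint sqrt_iter B n x : H :=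
  if n is m.+1
  then 2^-1%:C *: (B x + sqrt_iter B m (sqrt_iter B m x)) else 0.

Lemma self_adjoint_sqrt_iter B n :
  self_adjoint B -> self_adjoint (sqrt_iter B n).
Proof.
move=> hB; elim: n => [x y|n IH x y] /=; first by rewrite inner0l inner0r.
by rewrite innerZlr innerZr innerDl innerDr hB !IH.
Qed.

Lemma sqrt_iter_comm B T n x : (forall y z, T (y + z) = T y + T z) ->
  (forall (c : R[i]) y, T (c *: y) = c *: T y) ->
  (forall y, T (B y) = B (T y)) ->
  T (sqrt_iter B n x) = sqrt_iter B n (T x).
Proof.
move=> TD TZ TB; elim: n x => [|n IH] x /=.
  by rewrite -(scale0r 0) TZ !scale0r.
by rewrite TZ TD TB !IH.
Qed.

Lemma sqrt_iterS2 B n x :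
  2%:R *: sqrt_iter B n.+1 x = B x + sqrt_iter B n (sqrt_iter B n x).
Proof.
rewrite /= scalerA -(rmorph_nat (real_complex R)) -rmorphM /=.
by rewrite divff ?pnatr_eq0 // scale1r.
Qed.

(** With [Y_n = sqrt_iter B n], the recursion reads [Y_n^2 = 2 Y_(n+1) - B]. Hence [(1 - Y_n)^2]
    misses [1 - B] by twice an increment of the iteration. *)
Lemma sqrt_iter_sqr B n x : self_adjoint B ->
  let S y := y - sqrt_iter B n y in
  S (S x) = x - B x + 2%:R *: (sqrt_iter B n.+1 x - sqrt_iter B n x).
Proof.
move=> hB /=; have hY := self_adjoint_sqrt_iter _ n hB.
rewrite saB // scalerBr.
have := sqrt_iterS2 B n x; rewrite /= => ->; module.
Qed.

(* The sum of the coefficients of [sqrt_iter B n], which is a polynomial in [B]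
   with nonnegative coefficients. *)
Fixpoint sqrt_iter1 n : R :=
  if n is m.+1 then 2^-1 * (1 + sqrt_iter1 m ^+ 2) else 0.

Lemma sqrt_iter1_bounds n : 0 <= sqrt_iter1 n <= 1.
Proof. by elim: n => /= [|n]; [lra|nra]. Qed.

(** The distance [d] to the limit 1 evolves by [d - d^2 / 2], which increases in [d] on [[0, 1]];
    and [2 / m - 2 / m^2 <= 2 / (m + 1)]. *)
Lemma sqrt_iter1_rate n : 1 - sqrt_iter1 n <= 2%:R / n.+2%:R.
Proof.
elim: n => [|n IH]; first by rewrite /= divff ?pnatr_eq0 //; lra.
have := sqrt_iter1_bounds n; rewrite /=.
rewrite -[n.+3%:R]natr1.
have n2 : 2 <= n.+2%:R :> R by rewrite ler_nat.
move: IH; rewrite !ler_pdivlMr; [|lra..].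
move: (n.+2%:R : R) (sqrt_iter1 n) n2 => m y; move=> m2 h /andP[y0 y1].
nra.
Qed.

Definition sqrt_gap n : R := sqrt_iter1 n.+1 - sqrt_iter1 n.

(** The gap equals [(1 - sqrt_iter1 n)^2 / 2]. *)
Lemma sqrt_gap_le n : sqrt_gap n <= n.+1%:R^-1.
Proof.
have := sqrt_iter1_bounds n; have := sqrt_iter1_rate n.
rewrite /sqrt_gap /= -[n.+2%:R]natr1 -[n.+1%:R^-1]div1r.
rewrite !ler_pdivlMr ?ltr0n ?ltr_wpDl //.
have : 1 <= n.+1%:R :> R by rewrite ler1n.
move: (n.+1%:R : R) (sqrt_iter1 n) => m y m1 h /andP[y0 y1].
nra.
Qed.

(** This replaces an operator bound for [B]: a polynomial in [B] with nonnegative coefficients of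
    sum [c] turns the bound [M] into [c * M]. *)
Definition orbit_le B M x := forall k, nrm (iter k B x) <= M.

Lemma orbit_leD B M N x y : self_adjoint B ->
  orbit_le B M x -> orbit_le B N y -> orbit_le B (M + N) (x + y).
Proof.
move=> hB hx hy k; rewrite (saD _ (self_adjoint_iter k _ hB)).
by apply: le_trans (nrmD _ _) _; apply: lerD.
Qed.

Lemma orbit_leZ B M r x : self_adjoint B -> 0 <= r ->
  orbit_le B M x -> orbit_le B (r * M) (r%:C *: x).
Proof.
move=> hB r0 hx k; rewrite (saZ _ (self_adjoint_iter k _ hB)).
by rewrite nrmZr ger0_norm // ler_wpM2l.
Qed.

Lemma orbit_leB B M x : orbit_le B M x -> orbit_le B M (B x).
Proof. by move=> hx k; rewrite -iterSr. Qed.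

Lemma orbit_le_sqrt_iter B n M x : self_adjoint B ->
  orbit_le B M x -> orbit_le B (sqrt_iter1 n * M) (sqrt_iter B n x).
Proof.
move=> hB; elim: n M x => [|n IH] M x hx.
  by rewrite /= mul0r => k; rewrite (sa0 _ (self_adjoint_iter k _ hB)) nrm0.
rewrite /= -mulrA; apply: orbit_leZ => //.
rewrite mulrDl mul1r expr2 -mulrA; apply: orbit_leD => //; first exact: orbit_leB.
exact: IH _ _ (IH _ _ hx).
Qed.

(* With [Y_n = sqrt_iter B n],
   [Y_(n+1)^2 - Y_n^2 = Y_(n+1) (Y_(n+1) - Y_n) + (Y_(n+1) - Y_n) Y_n], so that
   the increments too are polynomials in [B] with nonnegative coefficients. *)
Lemma orbit_le_sqrt_gap B n M x : self_adjoint B -> orbit_le B M x ->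
  orbit_le B (sqrt_gap n * M) (sqrt_iter B n.+1 x - sqrt_iter B n x).
Proof.
move=> hB; elim: n M x => [|n IH] M x hx.
  rewrite /sqrt_gap /= subr0 addr0 subr0 expr0n addr0 mulr1.
  by apply: orbit_leZ; [|lra|exact: orbit_leB].
have -> : sqrt_iter B n.+2 x - sqrt_iter B n.+1 x =
    2^-1%:C *: (sqrt_iter B n.+1 (sqrt_iter B n.+1 x - sqrt_iter B n x) +
     (sqrt_iter B n.+1 (sqrt_iter B n x) - sqrt_iter B n (sqrt_iter B n x))).
  rewrite (saB (sqrt_iter B n.+1)); last exact: self_adjoint_sqrt_iter.
  rewrite [sqrt_iter B n.+2 x]/= -/(sqrt_iter B n.+1).
  by rewrite [X in _ - X = _]/= -/(sqrt_iter B n.+1) -scalerBr; congr (_ *: _); module.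
have -> : sqrt_gap n.+1 * M =
   2^-1 * (sqrt_iter1 n.+1 * (sqrt_gap n * M) + sqrt_gap n * (sqrt_iter1 n * M)).
  by rewrite /sqrt_gap /=; field.
apply: orbit_leZ => //.
apply: orbit_leD => //.
  by apply: orbit_le_sqrt_iter => //; apply: IH.
by apply: IH; apply: orbit_le_sqrt_iter.
Qed.

End SelfAdjoint.

Lemma ler_archi {R : realType} (a b c : R) :
  (forall n, a <= b + c * n.+1%:R^-1) -> a <= b.
Proof.
move=> h; apply/ler_addgt0Pr => e e0.
have [c0|c0] := leP c 0.
  apply: le_trans (h 0) _; rewrite lerD2l.
  by rewrite invr1 mulr1 (le_trans c0) // ltW.
have := truncnS_gt (c / e); set n := Num.truncn _ => cn.
apply: le_trans (h n) _; rewrite lerD2l ler_pdivrMr ?ltr0n //.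
by rewrite mulrC -ler_pdivrMr // ltW.
Qed.

(** * From bounded orbits to norm bounds for self-adjoint maps *)

Section SpectralBound.
Local Open Scope complex_scope.
Context {R : realType} {A : cStarAlgType R} {H : hilbertModType A}.
Implicit Types (x y z : H) (S T : H -> H) (M : R).
Local Notation ip := (@inner R A H).

(* Approximates the square root of [1 - T^2]. *)
Definition coroot T n x := x - sqrt_iter (T \o T) n x.

Lemma self_adjoint_coroot T n : self_adjoint T -> self_adjoint (coroot T n).
Proof.
move=> hT x y; rewrite /coroot innerBl innerBr; congr (_ - _).
exact/self_adjoint_sqrt_iter/self_adjoint_sqr.
Qed.

Lemma coroot_comm T n S x : (forall y z, S (y + z) = S y + S z) ->
  (forall (c : R[i]) y, S (c *: y) = c *: S y) ->
  (forall y, S (T (T y)) = T (T (S y))) ->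
  S (coroot T n x) = coroot T n (S x).
Proof.
move=> SD SZ ST; rewrite /coroot SD -scaleN1r SZ scaleN1r.
by rewrite (sqrt_iter_comm _ S).
Qed.

Lemma coroot_sqr T n x : self_adjoint T ->
  ip (coroot T n x) (coroot T n x) = ip x x - ip (T x) (T x) +
    ip x (2%:R *: (sqrt_iter (T \o T) n.+1 x - sqrt_iter (T \o T) n x)).
Proof.
move=> hT; rewrite self_adjoint_coroot // /coroot.
by rewrite (sqrt_iter_sqr _ _ _ (self_adjoint_sqr _ hT)) innerDr innerBr hT.
Qed.

Lemma nrm_coroot_error T n M x : self_adjoint T -> orbit_le (T \o T) M x ->
  nrm (ip x (2%:R *: (sqrt_iter (T \o T) n.+1 x - sqrt_iter (T \o T) n x)))
    <= 8%:R * nrm x * M * n.+1%:R^-1.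
Proof.
move=> hT hx; apply: le_trans (nrm_inner_le _ _) _; rewrite nrmZn.
have := orbit_le_sqrt_gap _ n _ _ (self_adjoint_sqr _ hT) hx 0.
rewrite -[iter 0 _ _]/(_ - _) => h.
have M0 : 0 <= M by apply: le_trans (nrm_ge0 x) (hx 0).
have := ler_wpM2r M0 (sqrt_gap_le n) => h2.
have := ler_wpM2l (nrm_ge0 x) (le_trans h h2).
set N := nrm (_ - _); move: (nrm x) N (_^-1) => a N i; clear; lra.
Qed.

(** The cross terms are ['i *: ip x y] and [- 'i *: ip y x]. *)
Lemma inner_sqrDi x y : ip x y = ip y x ->
  ip (x + 'i *: y) (x + 'i *: y) = ip x x + ip y y.
Proof.
move=> xy; rewrite !innerDl !innerDr !innerZl !innerZr conjCi xy.
have ii : sqz_sc ('i : R[i]) * sqz_sc 'i = -1 :> sqz _ A.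
  by rewrite -rmorphM -expr2 sqrCi rmorphN1.
by apply: sqz_in_inj; rewrite !sqz_inE ?rmorphN; ring: ii.
Qed.

(* [T x] is the mean of the two vectors [(T +- i sqrt (1 - T^2)) x], and
   [T +- i sqrt (1 - T^2)] is an isometry. *)
Lemma orbit_bounded_contraction T M x : self_adjoint T ->
  orbit_le (T \o T) M x -> nrm (T x) <= nrm x.
Proof.
move=> hT hx.
rewrite -(@ler_pXn2r _ 2) ?nnegrE ?nrm_ge0 //.
apply: (@ler_archi _ _ _ (8%:R * nrm x * M)) => n.
set C := coroot T n x.
(* [coroot T n] is self-adjoint and commutes with [T]. *)
have TC : ip (T x) C = ip C (T x).
  rewrite /C (self_adjoint_coroot _ _ hT) hT; congr ip; apply: coroot_comm => //.
  - by move=> *; exact: saD.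
  - by move=> *; exact: saZ.
have U1 := inner_sqrDi _ _ TC.
have U2 : ip (T x - 'i *: C) (T x - 'i *: C) = ip (T x) (T x) + ip C C.
  by rewrite -scalerN inner_sqrDi ?innerNl ?innerNr ?opprK // TC.
have := nrm_coroot_error _ n _ _ hT hx; set e := ip x _ => he.
have UC : ip (T x) (T x) + ip C C = ip x x + e.
  by rewrite /C coroot_sqr // -/e; module.
have := nrmD (ip x x) e; rewrite -UC nrm_inner => hU.
have h1 : nrm (T x + 'i *: C) ^+ 2 <= nrm x ^+ 2 + 8%:R * nrm x * M * n.+1%:R^-1.
  by rewrite -nrm_inner U1; apply: le_trans hU _; rewrite lerD2l.
have h2 : nrm (T x - 'i *: C) ^+ 2 <= nrm x ^+ 2 + 8%:R * nrm x * M * n.+1%:R^-1.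
  by rewrite -nrm_inner U2; apply: le_trans hU _; rewrite lerD2l.
have : nrm (2%:R *: T x) <= nrm (T x + 'i *: C) + nrm (T x - 'i *: C).
  have -> : 2%:R *: T x = (T x + 'i *: C) + (T x - 'i *: C) by module.
  exact: nrmD.
rewrite nrmZn; have := nrm_ge0 (T x).
have := nrm_ge0 (T x + 'i *: C); have := nrm_ge0 (T x - 'i *: C).
move: (nrm (T x)) (nrm (T x + _)) (nrm (T x - _)) h1 h2 => t u v.
move: (_ + _ * _^-1) => w; clear; move=> *.
(* The chain is [4 t^2 <= (u + v)^2 <= 2 u^2 + 2 v^2 <= 4 w]. *)
have : (2 * t) ^+ 2 <= (u + v) ^+ 2 by rewrite lerXn2r ?nnegrE; lra.
have := sqr_ge0 (u - v).
lra.
Qed.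

(** Rescaling: the case [b = 1] is applied to [b^-1 T]. The constant [M] leaves no trace in the
    conclusion. *)
Lemma orbit_geometric_bound T (b M : R) x : self_adjoint T -> 0 < b ->
  (forall k, nrm (iter k (T \o T) x) <= M * (b ^+ 2) ^+ k) ->
  nrm (T x) <= b * nrm x.
Proof.
move=> hT b0 hx.
have hbT := self_adjointZ b^-1 _ hT.
have : nrm (b^-1%:C *: T x) <= nrm x.
  apply: (orbit_bounded_contraction _ M _ hbT) => k.
  have -> : iter k ((fun x => b^-1%:C *: T x) \o (fun x => b^-1%:C *: T x)) x =
            ((b ^+ 2) ^- k)%:C *: iter k (T \o T) x.
    elim: k => [|k IH]; first by rewrite expr0 invr1 scale1r.
    rewrite !iterS IH /= !(saZ _ hT) !scalerA -!rmorphM /=.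
    by rewrite [_ ^+ k.+1]exprS invfM expr2 invfM !mulrA.
  rewrite nrmZr ger0_norm ?invr_ge0 ?exprn_ge0 ?(ltW b0) //.
  by rewrite ler_pdivrMl ?exprn_gt0 // [leRHS]mulrC hx.
by rewrite nrmZr ger0_norm ?invr_ge0 ?(ltW b0) // ler_pdivrMl.
Qed.

End SpectralBound.

(** * The algebra of two projections and the contractions built from them *)

Section TwoProjections.
Local Open Scope complex_scope.
Context {R : realType} {A : cStarAlgType R} {H : hilbertModType A}.
Context {P Q : H -> H} (hP : self_adjoint P) (hQ : self_adjoint Q).
Context (PP : forall x, P (P x) = P x) (QQ : forall x, Q (Q x) = Q x).
Implicit Types x y z u v w : H.
Local Notation ip := (@inner R A H).

Definition psum x := P x + Q x - x.
Definition pdiff x := P x - Q x.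
Local Notation S := psum.
Local Notation D := pdiff.

Lemma self_adjoint_psum : self_adjoint S.
Proof. by move=> x y; rewrite /S innerBl innerBr innerDl innerDr hP hQ. Qed.
Let hS := self_adjoint_psum.

Lemma self_adjoint_pdiff : self_adjoint D.
Proof. by move=> x y; rewrite /D innerBl innerBr hP hQ. Qed.
Let hD := self_adjoint_pdiff.

Let simp := (saB _ hP, saB _ hQ, saD _ hP, saD _ hQ,
             saN _ hP, saN _ hQ, PP, QQ).

Lemma proj_psuml x : P (S x) = S (Q x).
Proof. by rewrite /S !simp; module. Qed.

Lemma proj_psumr x : Q (S x) = S (P x).
Proof. by rewrite /S !simp; module. Qed.

Lemma proj_pdiffl x : P (D x) = D (x - Q x).
Proof. by rewrite /D !simp; module. Qed.

Lemma psum_sqr x : S (S x) = x - D (D x).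
Proof. by rewrite /S /D !simp; module. Qed.

Lemma proj_pdiff_sqr x : Q (D (D x)) = D (D (Q x)).
Proof. by rewrite /D !simp; module. Qed.

Lemma psum_pdiff_sqr x : S (D (D x)) = D (D (S x)).
Proof.
have E z : D (D z) = z - S (S z) by rewrite psum_sqr; module.
by rewrite !E (saB _ hS).
Qed.

Lemma psum_sqr_proj x : Q (S (S x)) = S (S (Q x)).
Proof. by rewrite proj_psumr proj_psuml. Qed.

(** [2 T - 1] is a self-adjoint involution, hence an isometry. As [2 S], [2 D] and [2 Q] are sums or
    differences of such maps and the identity, [S], [D] and [Q] are contractions. *)
Lemma nrm_reflection T x : self_adjoint T -> (forall y, T (T y) = T y) ->
  nrm (T x - (x - T x)) = nrm x.
Proof.
move=> hT TT; apply/eqP; rewrite -(@eqrXn2 _ 2) ?nrm_ge0 //.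
rewrite -!nrm_inner; apply/eqP; congr nrm.
have sa y z : ip (T y - (y - T y)) z = ip y (T z - (z - T z)).
  by rewrite !innerBl !innerBr hT.
by rewrite sa !(saB _ hT) !TT; congr ip; module.
Qed.

Lemma nrm_psum_le x : nrm (S x) <= nrm x.
Proof.
have : nrm (2%:R *: S x) <= nrm (P x - (x - P x)) + nrm (Q x - (x - Q x)).
  have -> : 2%:R *: S x = (P x - (x - P x)) + (Q x - (x - Q x)).
    by rewrite /S; module.
  exact: nrmD.
by rewrite nrmZn !nrm_reflection //; lra.
Qed.

Lemma nrm_pdiff_le x : nrm (D x) <= nrm x.
Proof.
have : nrm (2%:R *: D x) <= nrm (P x - (x - P x)) + nrm (Q x - (x - Q x)).
  have -> : 2%:R *: D x = (P x - (x - P x)) - (Q x - (x - Q x)).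
    by rewrite /D; module.
  exact: nrmB.
by rewrite nrmZn !nrm_reflection //; lra.
Qed.

Lemma nrm_proj_le x : nrm (Q x) <= nrm x.
Proof.
have : nrm (2%:R *: Q x) <= nrm (Q x - (x - Q x)) + nrm x.
  have -> : 2%:R *: Q x = (Q x - (x - Q x)) + x by module.
  exact: nrmD.
by rewrite nrmZn !nrm_reflection //; lra.
Qed.

Lemma nrm_iter_le (T : H -> H) (b : R) (K : H -> Prop) k v : 0 <= b ->
  (forall w, K w -> K (T w)) -> (forall w, K w -> nrm (T w) <= b * nrm w) ->
  K v -> nrm (iter k T v) <= b ^+ k * nrm v.
Proof.
move=> b0 KT Tb; elim: k v => [|k IH] v Kv; first by rewrite expr0 mul1r.
rewrite iterSr exprSr -mulrA; apply: le_trans (IH _ (KT _ Kv)) _.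
by rewrite ler_wpM2l ?exprn_ge0 // Tb.
Qed.

Lemma pdiff_orbit x : orbit_le (D \o D) (nrm x) x.
Proof.
move=> k; have := @nrm_iter_le (D \o D) 1 (fun=> True) k x.
rewrite expr1n mul1r; apply => // w _; rewrite mul1r.
exact: le_trans (nrm_pdiff_le _) (nrm_pdiff_le _).
Qed.

Lemma inner_psum x : ip (S x) (S x) = ip x x - ip (D x) (D x).
Proof. by rewrite hS psum_sqr innerBr -hD. Qed.

(* [coroot D n] tends to the absolute value of [S]. *)
Lemma nrm_coroot_le n x :
  nrm (coroot D n x) ^+ 2 <= nrm (S x) ^+ 2 + 8%:R * nrm x * nrm x * n.+1%:R^-1.
Proof.
have := nrm_coroot_error D n _ _ hD (pdiff_orbit x).
rewrite -!nrm_inner coroot_sqr // -inner_psum => he.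
by apply: le_trans (nrmD _ _) _; rewrite lerD2l.
Qed.

Lemma nrm_coroot_ge n x :
  nrm (S x) ^+ 2 <= nrm (coroot D n x) ^+ 2 + 8%:R * nrm x * nrm x * n.+1%:R^-1.
Proof.
have := nrm_coroot_error D n _ _ hD (pdiff_orbit x).
set e := ip x _ => he.
have Se : ip (S x) (S x) = ip (coroot D n x) (coroot D n x) - e.
  by rewrite coroot_sqr // -inner_psum addrK.
by rewrite -!nrm_inner Se; apply: le_trans (nrmB _ _) _; rewrite lerD2l.
Qed.

(** * Transport of bounds from the null space of [Q] to its range, inside an invariant submodule
    [K] *)

Context (K : H -> Prop) (KD : forall x y, K x -> K y -> K (x + y)).
Context (KZ : forall (c : R[i]) x, K x -> K (c *: x)).
Context (KP : forall x, K x -> K (P x)) (KQ : forall x, K x -> K (Q x)).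
Context (K_dense : forall x (e : R), K x -> 0 < e ->
  exists2 u, K u & nrm (x - D u) < e).
Context (b : R) (b0 : 0 < b).
Context (S_ker : forall v, K v -> Q v = 0 -> nrm (S v) <= b * nrm v).

Let KB x y : K x -> K y -> K (x - y).
Proof. by move=> Kx Ky; rewrite -[- y]scaleN1r; apply: KD => //; apply: KZ. Qed.

Let KS x : K x -> K (S x).
Proof. by move=> Kx; apply: KB => //; apply: KD; [apply: KP|apply: KQ]. Qed.

Let KC n x : K x -> K (coroot D n x).
Proof.
move=> Kx; apply: KB => //; elim: n x Kx => [|n IH] x Kx /=.
  by rewrite -(scale0r x); apply: KZ.
apply/KZ/KD; last exact/IH/IH.
by do 2 (apply: KB; [apply: KP|apply: KQ]); try exact: KB (KP _ Kx) (KQ _ Kx).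
Qed.

(* The bound [|S v| <= b |v|] on the kernel of [Q] passes to the adjoint of the
   restriction of [S] because [S] and its absolute value have the same norm on
   each vector, and the absolute value commutes with [Q]. *)
Lemma psum_sqr_ker v : K v -> Q v = 0 -> nrm (S (S v)) <= b * nrm (S v).
Proof.
move=> Kv Qv; rewrite -(@ler_pXn2r _ 2) ?nnegrE ?mulr_ge0 ?nrm_ge0 ?(ltW b0) //.
(* The two summands are the errors of replacing [S] by [coroot D n] at [S v] and, weighted by [b^2],
   at [v]. *)
apply: (@ler_archi _ _ _
  (8%:R * nrm (S v) * nrm (S v) + b ^+ 2 * (8%:R * nrm v * nrm v))) => n.
apply: le_trans (nrm_coroot_ge n _) _.
have -> : coroot D n (S v) = S (coroot D n v).
  apply/esym/coroot_comm => *; [exact: saD|exact: saZ|exact: psum_pdiff_sqr].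
have QC : Q (coroot D n v) = 0.
  rewrite (coroot_comm _ _ Q) ?Qv => *; [|exact: saD|exact: saZ|exact: proj_pdiff_sqr].
  exact/sa0/self_adjoint_coroot.
have h1 : nrm (S (coroot D n v)) ^+ 2 <= b ^+ 2 * nrm (coroot D n v) ^+ 2.
  rewrite -exprMn lerXn2r ?nnegrE ?mulr_ge0 ?nrm_ge0 ?(ltW b0) //.
  by apply: S_ker => //; apply: KC.
have h2 := ler_wpM2l (sqr_ge0 b) (nrm_coroot_le n v).
rewrite exprMn [(_ + _) * n.+1%:R^-1]mulrDl [leRHS]addrCA [leLHS]addrC lerD2l.
by rewrite -[X in _ <= _ + X]mulrA -mulrDr; apply: le_trans h1 h2.
Qed.

Lemma psum_iter_ker k v : K v -> Q v = 0 ->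
  nrm (iter k (S \o S) v) <= (b ^+ 2) ^+ k * nrm v.
Proof.
move=> Kv Qv; apply: (nrm_iter_le _ _ (fun w => K w /\ Q w = 0)) => //.
- exact: sqr_ge0.
- move=> w [Kw Qw]; split; first by do 2 apply: KS.
  by rewrite /= psum_sqr_proj Qw !(sa0 _ hS).
- move=> w [Kw Qw] /=; apply: le_trans (psum_sqr_ker _ Kw Qw) _.
  by rewrite expr2 -mulrA ler_pM2l // S_ker.
Qed.

(** [Q S D u = S D z] with [z = u - Q u] in the null space of [Q]. Powers of [S^2] commute with
    [S D] up to the iterates of [z], whose decay is known, so the constant [nrm z] is absorbed by
    [orbit_geometric_bound], applied to [S^2] with the bound [b^2]. *)
Lemma psum_sqr_pdiff u : K u ->
  nrm (S (S (Q (S (D u))))) <= b ^+ 2 * nrm (Q (S (D u))).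
Proof.
move=> Ku; rewrite proj_psumr proj_pdiffl.
apply: (orbit_geometric_bound (S \o S) _ (nrm (u - Q u))) => [||k].
- exact: self_adjoint_sqr.
- exact: exprn_gt0.
have SSD z : iter k.*2 (S \o S) (S (D z)) = S (D (iter k.*2 (S \o S) z)).
  elim: (k.*2) => [//|m IH]; rewrite !iterS IH /=; congr S.
  by rewrite !psum_sqr -(saB _ hD).
rewrite (_ : iter _ _ _ = iter k.*2 (S \o S) (S (D (u - Q u)))); last first.
  by rewrite -muln2 iterM.
rewrite SSD; apply: le_trans (nrm_psum_le _) _; apply: le_trans (nrm_pdiff_le _) _.
rewrite -[_ ^+ 2 ^+ 2 ^+ k]exprM mulnC muln2 mulrC; apply: psum_iter_ker.
- by apply: KB => //; apply: KQ.
- by rewrite (saB _ hQ) QQ subrr.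
Qed.

(** If [D u] approximates [S v], then [y = Q S D u] approximates [Q S S v = S S v], and the bound
    for [y] passes to the limit. *)
Lemma psum_sqr_range v : K v -> Q v = v ->
  nrm (S (S (S (S v)))) <= b ^+ 2 * nrm (S (S v)).
Proof.
move=> Kv Qv; set w := S (S v); apply/ler_addgt0Pr => e e0.
(* An error [d] in [w] costs [d] on the left-hand side and [b^2 d] on the right-hand side. *)
have c0 : 0 < b ^+ 2 + 1 by rewrite ltr_wpDl ?sqr_ge0.
have [u Ku ue] := K_dense _ _ (KS _ Kv) (divr_gt0 e0 c0).
set y := Q (S (D u)).
have wy : nrm (w - y) < e / (b ^+ 2 + 1).
  have -> : w = Q (S (S v)) by rewrite psum_sqr_proj Qv.
  rewrite -(saB _ hQ) -(saB _ hS).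
  by apply: le_lt_trans ue; apply: le_trans (nrm_proj_le _) (nrm_psum_le _).
have h1 : nrm (S (S w)) <= nrm (S (S (w - y))) + nrm (S (S y)).
  by apply: le_trans (nrmD _ _); rewrite -!(saD _ hS) subrK.
have h2 := le_trans (nrm_psum_le (S (w - y))) (nrm_psum_le _).
have h3 := psum_sqr_pdiff _ Ku.
have h4 : nrm y <= nrm w + nrm (w - y).
  by apply: le_trans (nrmB _ _); rewrite opprB addrC subrK.
have h5 := ler_wpM2l (sqr_ge0 b) h4.
move: wy; rewrite ltr_pdivlMr // => wy.
move: h3 h5; rewrite -/y; move: (b ^+ 2) wy => c; lra.
Qed.

Lemma psum_range v : K v -> Q v = v -> nrm (S v) <= b * nrm v.
Proof.
move=> Kv Qv; have b2 : 0 < b ^+ 2 by apply: exprn_gt0.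
(* Decay is known only from [S (S v)] on: [nrm v] covers [k = 0], and dividing by [b^2] makes up for
   the lost step. *)
apply: (orbit_geometric_bound S _ (nrm v + nrm (S (S v)) / b ^+ 2)) => // k.
case: k => [|k]; first by rewrite /= mulr1 lerDl divr_ge0 ?nrm_ge0 ?ltW.
rewrite iterSr; set w := (S \o S) v.
have : nrm (iter k (S \o S) w) <= (b ^+ 2) ^+ k * nrm w.
  apply: (nrm_iter_le _ _ (fun w => exists v, [/\ K v, Q v = v & w = S (S v)])).
  - exact: ltW.
  - move=> _ [x [Kx Qx ->]]; exists (S (S x)); split => //; first by do 2 apply: KS.
    by rewrite psum_sqr_proj Qx.
  - by move=> _ [x [Kx Qx ->]]; apply: psum_sqr_range.
  - by exists v.
move=> /le_trans; apply.
rewrite mulrDl [_ ^+ k.+1]exprS [_ / _ * _]mulrA divfK ?gt_eqF // mulrC.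
by rewrite lerDr mulr_ge0 ?nrm_ge0 // mulr_ge0 ?exprn_ge0 // ltW.
Qed.

End TwoProjections.

(** * Operator norms, complements, and the inequality between the two compressions *)

Section Norms.
Local Open Scope complex_scope.
Context {R : realType} {A : cStarAlgType R} {H : hilbertModType A}.
Implicit Types (x y z w : H) (P Q E F T : H -> H).
Local Notation ip := (@inner R A H).

Lemma opnorm_le T1 T2 : (forall (c : R[i]) x, T2 (c *: x) = c *: T2 x) ->
  (forall b : R, 0 < b -> (forall x, nrm (T2 x) <= b * nrm x) ->
    forall x, nrm (T1 x) <= b * nrm x) ->
  (opnorm T1 <= opnorm T2)%E.
Proof.
move=> T2Z T12.
have ub x : nrm x <= 1 -> ((nrm (T2 x))%:E <= opnorm T2)%E.
  move=> x1; apply: ereal_sup_ubound; exists x => //=.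
  by rewrite nrmE -(rmorph1 (real_complex R)) lecR.
have T20 : T2 0 = 0 by rewrite -(scale0r 0) T2Z !scale0r.
have := ub 0; rewrite T20 nrm0 => /(_ ler01).
case: (opnorm T2) ub => [r ub r0| _ _ |_]; [|exact: leey|by []].
rewrite lee_fin in r0.
(* The hypothesis asks for a positive bound, so it is used with [r + e] rather than [r]. *)
apply/lee_addgt0Pr => e e0; apply: ub_ereal_sup => _ [x x1 <-].
rewrite -EFinD lee_fin -/(nrm (T1 x)).
have re : 0 < r + e by rewrite ltr_wpDl.
have {}x1 : nrm x <= 1.
  by move: x1; rewrite /= nrmE -(rmorph1 (real_complex R)) lecR.
apply: le_trans (_ : (r + e) * nrm x <= _); last by rewrite ler_piMr // ltW.
apply: T12 => // y; have [y0|y0] := eqVneq (nrm y) 0.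
  by rewrite y0 mulr0 (nrm_eq0 _ y0) T20 nrm0.
have yp : 0 < nrm y by rewrite lt_def y0 nrm_ge0.
have := ub ((nrm y)^-1%:C *: y); rewrite T2Z !nrmZr ger0_norm ?invr_ge0 ?nrm_ge0 //.
rewrite mulVf // lexx lee_fin => /(_ isT); rewrite ler_pdivrMl // mulrC => h.
by apply: le_trans h _; rewrite ler_pM2r // lerDl ltW.
Qed.

Lemma orthogonal_complement_range T : self_adjoint T ->
  orthogonal_complement (closure (range T)) = null_space T.
Proof.
move=> hT; apply/seteqP; split=> z /= Mz.
  apply: inner_ext => y; rewrite inner0r -hT inner_star Mz ?astar0 //.
  by apply: subset_closure; exists y.
move=> y /closure_nrm My; apply: nrm_eq0; apply/eqP; rewrite eq_le nrm_ge0 andbT.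
apply/ler_addgt0Pr => e e0; rewrite add0r.
(* The 4 comes from [nrm_inner_le]; adding 1 keeps the divisor positive. *)
have z0 : 0 < 4%:R * nrm z + 1 by rewrite ltr_wpDl // mulr_ge0 // nrm_ge0.
have [_ [w _ <-] yw] := My _ (divr_gt0 e0 z0).
have -> : ip z y = ip z (y - T w) by rewrite innerBr -hT Mz inner0l subr0.
apply: le_trans (nrm_inner_le _ _) _; move: yw; rewrite ltr_pdivlMr //.
have := nrm_ge0 (y - T w); lra.
Qed.

Lemma projection_self_adjoint P : projection P -> self_adjoint P.
Proof. by case. Qed.

Lemma projection_idem P : projection P -> forall x, P (P x) = P x.
Proof. by case=> _ PP _ x; rewrite -[in RHS]PP. Qed.

Lemma range_projection P : projection P -> range P = [set x | P x = x].
Proof.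
move=> hP; apply/seteqP; split=> [_ [x _ <-]|x <-] /=; last by exists x.
exact: projection_idem.
Qed.

Lemma projectionP P : self_adjoint P -> (forall x, P (P x) = P x) ->
  projection P.
Proof. by move=> hP PP; split=> //; [exists P|apply/funext]. Qed.

Lemma projectionC P : projection P -> projection (idfun \- P).
Proof.
move=> hP; have sP := projection_self_adjoint _ hP.
apply: projectionP => [x y|x] /=; first by rewrite innerBl innerBr sP.
by rewrite (saB _ sP) (projection_idem _ hP) subrr subr0.
Qed.

Lemma null_spaceC P : null_space (idfun \- P) = [set x | P x = x].
Proof.
apply/seteqP; split=> x /=; rewrite /null_space /=.
  by move=> /eqP; rewrite subr_eq0 => /eqP.
by move=> ->; rewrite subrr.
Qed.

(** Positivity in [A] is avoided: [(P + Q) x = 0] gives [S x = - x], so [D^2 x = x - S^2 x = 0],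
    then [D x = 0], and [2 P x = (P + Q) x + D x = 0]. *)
Lemma null_space_projD P Q : projection P -> projection Q ->
  null_space (P \+ Q) = null_space P `&` null_space Q.
Proof.
move=> hP hQ; have sP := projection_self_adjoint _ hP.
have sQ := projection_self_adjoint _ hQ.
apply/seteqP; split=> x; last by rewrite /null_space /= => -[-> ->]; rewrite addr0.
rewrite /null_space /= => PQx.
have Sx : psum (P := P) (Q := Q) x = - x by rewrite /psum PQx add0r.
have Dx : pdiff (P := P) (Q := Q) x = 0.
  apply: (inner_eq0 (s:=H)); rewrite (self_adjoint_pdiff sP sQ).
  have := psum_sqr sP sQ (projection_idem _ hP) (projection_idem _ hQ) x.
  rewrite Sx (saN _ (self_adjoint_psum sP sQ)) Sx opprK => /eqP.
  rewrite eq_sym -subr_eq0 addrAC subrr add0r oppr_eq0 => /eqP ->.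
  by rewrite inner0r.
have Px : P x = 0.
  have /eqP : 2%:R *: P x = 0.
    by rewrite -[RHS](addr0 0) -[X in _ = X + _]PQx -Dx /pdiff; module.
  by rewrite scaler_eq0 pnatr_eq0 => /eqP.
by split=> //; move: PQx; rewrite Px add0r.
Qed.

Lemma proj_onto_orthogonal_complement (M : set H) :
  orthogonally_complemented M ->
  let E := proj_onto (orthogonal_complement M) in
  [/\ projection E, range E = orthogonal_complement M
    & forall x, M (x - E x)].
Proof.
move=> hM E; set N := orthogonal_complement M in E *.
have NB x y : N x -> N y -> N (x - y).
  by move=> Nx Ny z Mz; rewrite innerBl Nx // Ny // subrr.
have NM x : N x -> M x -> x = 0.
  by move=> Nx Mx; apply: (inner_eq0 (s:=H)); apply: Nx.
have MN x y : M x -> N y -> ip x y = 0.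
  by move=> Mx Ny; rewrite inner_star Ny ?astar0.
have [projE rangeE] : projection E /\ range E = N.
  (* One such projection suffices: the [N]-component of the decomposition along [M] and [N]. *)
  apply: (@xgetPex _ (fun=> 0) [set P | projection P /\ range P = N]).
  have /choice[f hf] : forall x, exists z, M (x - z) /\ N z.
    by move=> x; have [y [z [My Nz ->]]] := hM x; exists z; rewrite addrK.
  have fN z : N z -> f z = z.
    move=> Nz; have [Mf Nf] := hf z; apply/eqP; rewrite eq_sym -subr_eq0.
    by apply/eqP/NM => //; apply: NB.
  exists f; split; last first.
    apply/seteqP; split=> [_ [x _ <-]|x Nx]; first by case: (hf x).
    by exists x => //; apply: fN.
  apply: projectionP => [x y|x]; last by apply: fN; case: (hf x).
  have [Mx Nx] := hf x; have [My Ny] := hf y.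
  rewrite -[in LHS](subrK (f y) y) innerDr Nx // add0r.
  by rewrite -[in RHS](subrK (f x) x) innerDl (MN (x - f x)) // add0r.
split=> // x; have [y [z [My Nz ->]]] := hM x.
have sE := projection_self_adjoint _ projE.
have EN w : N (E w) by rewrite -[N]rangeE; exists w.
(* [E] fixes [N], and it kills [M] because it is self-adjoint with values in [N]. *)
have -> : E y = 0 -> E z = z -> y + z - E (y + z) = y.
  by move=> Ey Ez; rewrite (saD _ sE) Ey Ez add0r addrK.
- by [].
- by apply: inner_ext => w; rewrite -sE inner0r (EN w).
- have : range E z by rewrite rangeE.
  by rewrite (range_projection _ projE).
Qed.

(* [E] and [F] are the projections onto the common range and the common null
   space. *)
Record common_projections P Q E F : Prop := CommonProjections {
  cpP : projection P; cpQ : projection Q; cpE : projection E; cpF : projection F;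
  cpPE : forall x, P (E x) = E x; cpQE : forall x, Q (E x) = E x;
  cpPF : forall x, P (F x) = 0; cpQF : forall x, Q (F x) = 0;
  cpE_dense : forall x (e : R), 0 < e ->
    exists w, nrm (x - E x - (2%:R *: w - P w - Q w)) < e;
  cpF_dense : forall x (e : R), 0 < e ->
    exists w, nrm (x - F x - (P w + Q w)) < e }.

(** Complementing both projections exchanges [E] and [F]; this symmetry reduces the equality of
    norms to one inequality. *)
Lemma common_projectionsC P Q E F : common_projections P Q E F ->
  common_projections (idfun \- P) (idfun \- Q) F E.
Proof.
case=> hP hQ hE hF PE QE PF QF dE dF; split; try exact: projectionC.
- by [].
- by [].
- by move=> x; rewrite /= PF subr0.
- by move=> x; rewrite /= QF subr0.
- by move=> x; rewrite /= PE subrr.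
- by move=> x; rewrite /= QE subrr.
- move=> x e /(dF x)[w]; exists w; rewrite /=.
  by have -> : 2%:R *: w - (w - P w) - (w - Q w) = P w + Q w by module.
- move=> x e /(dE x)[w]; exists w; rewrite /=.
  by have -> : (w - P w) + (w - Q w) = 2%:R *: w - P w - Q w by module.
Qed.

Lemma compression_bound P Q E F (b : R) : common_projections P Q E F -> 0 < b ->
  (forall x, nrm ((idfun \- P) ((idfun \- Q) ((idfun \- F) x))) <= b * nrm x) ->
  forall x, nrm (P (Q ((idfun \- E) x))) <= b * nrm x.
Proof.
move=> [hP hQ hE hF PE QE PF QF dE dF] b0 hb.
have sP := projection_self_adjoint _ hP; have sQ := projection_self_adjoint _ hQ.
have sE := projection_self_adjoint _ hE; have sF := projection_self_adjoint _ hF.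
have PP := projection_idem _ hP; have QQ := projection_idem _ hQ.
have EE := projection_idem _ hE; have FF := projection_idem _ hF.
have EP x : E (P x) = E x by apply: inner_ext => z; rewrite -sE -sP PE sE.
have EQ x : E (Q x) = E x by apply: inner_ext => z; rewrite -sE -sQ QE sE.
have FP x : F (P x) = 0.
  by apply: inner_ext => z; rewrite -sF -sP PF inner0r inner0l.
have FQ x : F (Q x) = 0.
  by apply: inner_ext => z; rewrite -sF -sQ QF inner0r inner0l.
have EF x : E (F x) = 0 by rewrite -EP PF (sa0 _ sE).
have FE x : F (E x) = 0 by rewrite -PE FP.
have simp := (saB _ sP, saB _ sQ, saB _ sE, saB _ sF, saD _ sP, saD _ sQ,
  saD _ sE, saD _ sF, saZ _ sP, saZ _ sQ, saZ _ sE, saZ _ sF).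
pose K x := E x = 0 /\ F x = 0.
have KG w : K (w - E w - F w).
  by split; rewrite !simp ?EE ?FF ?EF ?FE ?subr0 ?subrr.
have KP x : K x -> K (P x) by case=> Ex Fx; split; rewrite ?EP ?FP.
have KQ x : K x -> K (Q x) by case=> Ex Fx; split; rewrite ?EQ ?FQ.
have KD x y : K x -> K y -> K (x + y).
  by move=> [Ex Fx] [Ey Fy]; split; rewrite !simp ?Ex ?Fx ?Ey ?Fy addr0.
have KZ (c : R[i]) x : K x -> K (c *: x).
  by move=> [Ex Fx]; split; rewrite !simp ?Ex ?Fx scaler0.
have dK x e : K x -> 0 < e ->
    exists2 u, K u & nrm (x - pdiff (P := P) (Q := Q) u) < e.
  (* Cutting [w] and [w'] down to [K] turns the errors [r] and [r'] into [r - F r] and [r' - E r'],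
     at most doubling them; [2 - P - Q] at most doubles the second again, and
     [2 e / 8 + 4 e / 8 < e]. *)
  move=> [Ex Fx] e0; have e8 : 0 < e / 8%:R by rewrite divr_gt0.
  have [w] := dE x _ e8; rewrite Ex subr0; set r := x - _ => re.
  pose g := w - E w - F w; have [Eg Fg] : K g := KG w.
  have xg : x - (2%:R *: g - P g - Q g) = r - F r.
    rewrite /r /g !simp PE QE PF QF FP FQ Fx; module.
  clearbody g.
  have [w'] := dF g _ e8; rewrite Fg subr0; set r' := g - _ => re'.
  pose g' := w' - E w' - F w'.
  have gg : g - (P g' + Q g') = r' - E r'.
    rewrite /r' /g' !simp PE QE PF QF EP EQ Eg; module.
  have Kg' : K g' := KG w'; clearbody g'.
  (* Since [(2 - P - Q) (P + Q) = D^2], the two approximations combine to [x] being close to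
     [D (D g')]. *)
  exists (P g' - Q g').
    by rewrite -[- Q g']scaleN1r; apply: KD; [|apply: KZ]; auto.
  have -> : x - pdiff (P := P) (Q := Q) (P g' - Q g') =
      (r - F r) + (2%:R *: (r' - E r') - P (r' - E r') - Q (r' - E r')).
    rewrite -xg -gg /pdiff !simp PP QQ; module.
  have hF1 := nrm_proj_le sF FF r; have hE1 := nrm_proj_le sE EE r'.
  have h1 := nrmB r (F r); have h2 := nrmB r' (E r').
  set s := r' - E r' in h2 *.
  have h3 : nrm (2%:R *: s - P s - Q s) <= nrm (s - P s) + nrm (s - Q s).
    have -> : 2%:R *: s - P s - Q s = (s - P s) + (s - Q s) by module.
    exact: nrmD.
  have cP := projectionC _ hP; have cQ := projectionC _ hQ.
  have h4 := nrm_proj_le (projection_self_adjoint _ cP) (projection_idem _ cP) s.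
  have h5 := nrm_proj_le (projection_self_adjoint _ cQ) (projection_idem _ cQ) s.
  have h6 := nrmD (r - F r) (2%:R *: s - P s - Q s).
  rewrite /= in h4 h5; lra.
move=> x; pose v := Q ((idfun \- E) x).
have Kv : K v by split; rewrite /v /= ?EQ ?FQ // !simp EE subrr.
have Qv : Q v = v by rewrite /v QQ.
have -> : P v = psum (P := P) (Q := Q) v by rewrite /psum Qv addrK.
(* On these vectors [(1 - P) (1 - Q) (1 - F)] is [- S]. *)
have hS u : K u -> Q u = 0 -> nrm (psum (P := P) (Q := Q) u) <= b * nrm u.
  move=> [Eu Fu] Qu; apply: le_trans (hb u).
  rewrite /= Fu subr0 Qu subr0 /psum Qu addr0 -nrmN.
  by rewrite opprB.
apply: le_trans (psum_range sP sQ PP QQ K KD KZ KP KQ dK b b0 hS v Kv Qv) _.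
rewrite ler_pM2l //; apply: le_trans (nrm_proj_le sQ QQ _) _.
have cE := projectionC _ hE.
exact: nrm_proj_le (projection_self_adjoint _ cE) (projection_idem _ cE) x.
Qed.

Lemma opnorm_compression_le P Q E F : common_projections P Q E F ->
  (opnorm (P \o Q \o (idfun \- E))%R <=
   opnorm ((idfun \- P) \o (idfun \- Q) \o (idfun \- F))%R)%E.
Proof.
move=> h; apply: opnorm_le => [c x|b b0 hb]; last exact: compression_bound h b0 hb.
have lin T : projection T -> forall y, (idfun \- T) (c *: y) = c *: (idfun \- T) y.
  by move=> /projection_self_adjoint hT y; rewrite /= (saZ _ hT) -scalerBr.
by rewrite /= -![_ - _]/((idfun \- _) _) !lin //; case: h.
Qed.

End Norms.

Theorem lemma5p4 (R : realType) (A : cStarAlgType R) (H : hilbertModType A)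
    (P Q : H -> H) (hP : projection P) (hQ : projection Q)
    (hsum : orthogonally_complemented (closure (range (P \+ Q))))
    (hdiff : orthogonally_complemented
               (closure (range (fun x : H => 2 *: x - P x - Q x)))) :
  opnorm (P \o Q \o (idfun \- proj_onto (range P `&` range Q))) =
  opnorm ((idfun \- P) \o (idfun \- Q) \o
            (idfun \- proj_onto (null_space P `&` null_space Q))).
Proof.
have sa_sum (S T : H -> H) : projection S -> projection T ->
    self_adjoint (S \+ T).
  move=> /projection_self_adjoint sS /projection_self_adjoint sT x y.
  by rewrite /= innerDl innerDr sS sT.
have [cP cQ] := (projectionC _ hP, projectionC _ hQ).
have nullE : orthogonal_complement (closure (range (P \+ Q))) =
    null_space P `&` null_space Q.
  by rewrite orthogonal_complement_range ?null_space_projD //; apply: sa_sum.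
have diffE : (fun x => 2 *: x - P x - Q x) = (idfun \- P) \+ (idfun \- Q).
  by apply/funext => x /=; module.
have rangeE : orthogonal_complement
    (closure (range (fun x : H => 2 *: x - P x - Q x))) = range P `&` range Q.
  rewrite diffE orthogonal_complement_range; last exact: sa_sum.
  by rewrite null_space_projD // !null_spaceC !range_projection.
have := proj_onto_orthogonal_complement _ hsum.
have := proj_onto_orthogonal_complement _ hdiff.
rewrite nullE rangeE; set E := proj_onto _; set F := proj_onto _.
move=> /= [projE rE dE] [projF rF dF].
have cE x : (range P `&` range Q) (E x) by rewrite -rE; exists x.
have cF x : (null_space P `&` null_space Q) (F x) by rewrite -rF; exists x.
rewrite !range_projection // in cE.
have cp : common_projections P Q E F.
  split=> //; try by [move=> x; case: (cE x)|move=> x; case: (cF x)].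
  - by move=> x e /(closure_nrm _ _ _ (dE x))[_ [w _ <-]]; exists w.
  - by move=> x e /(closure_nrm _ _ _ (dF x))[_ [w _ <-]]; exists w.
(* The reverse inequality is the same one for the complementary projections. *)
apply/eqP; rewrite eq_le opnorm_compression_le //=.
have := opnorm_compression_le _ _ _ _ (common_projectionsC _ _ _ _ cp).
have CC (T : H -> H) : idfun \- (idfun \- T) = T.
  by apply/funext => x /=; module.
by rewrite !CC.
Qed.
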